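(* Let $\mathcal{G}$ be a nonempty finite family of connected graphs on a common vertex set $V$ with $|V|\ge 2$. Then: (1) $\operatorname{Sd}(\mathcal{G})=1$ if and only if $\mathcal{G}$ is a collection of paths that share a common leaf (that is, every $G\in\mathcal{G}$ is a path graph on $V$ and there is a vertex $v\in V$ that is a leaf of every $G\in\mathcal{G}$). (2) If $\mathcal{G}$ is a collection of paths, then $1\le \operatorname{Sd}(\mathcal{G})\le 2$.
   Context: All graphs are finite and simple. For a connected graph $G=(V,E)$, $d_G(x,y)$ denotes the length of a shortest path between $x$ and $y$ in $G$. A vertex $v$ resolves two vertices $x,y$ if $d_G(v,x)\ne d_G(v,y)$. A set $S\subseteq V$ is a metric generator for $G$ if every pair of distinct vertices of $G$ is resolved by some element of $S$. For a finite family $\mathcal{G}$ of connected graphs on a common vertex set $V$, a simultaneous metric generator for $\mathcal{G}$ is a set $S\subseteq V$ that is a metric generator for every graph in $\mathcal{G}$; the simultaneous metric dimension $\operatorname{Sd}(\mathcal{G})$ is the minimum cardinality of a simultaneous metric generator for $\mathcal{G}$. A leaf is a vertex of degree 1. A ''path'' here is a graph isomorphic to the path $P_n$ with $n=|V|$. *)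

(* Defs.v *)
From mathcomp Require Import all_boot.

Set Implicit Arguments.
Unset Strict Implicit.
Unset Printing Implicit Defensive.

Record sgraph (V : finType) := SGraph {
  adj :> rel V;
  adj_sym : symmetric adj;
  adj_irr : irreflexive adj
}.

Section Graphs.

Variables (V : finType) (G : sgraph V).

Definition is_connected : Prop := forall x y : V, connect G x y.

Definition has_path_of_length (x y : V) (n : nat) : bool :=
  [exists p : n.-tuple V, [&& path G x p, uniq (x :: p) & last x p == y]].

(* A path has at most #|V| - 1 edges, so the first n in 0, ..., #|V| - 1 that
   is the length of a path from x to y is the distance. If there is no path
   (excluded for connected graphs), the value is #|V|. *)
Definition dist (x y : V) : nat :=
  find (has_path_of_length x y) (iota 0 #|V|).

Definition resolves (v x y : V) : bool := dist v x != dist v y.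

Definition metric_generator (S : {set V}) : bool :=
  [forall x, forall y, (x != y) ==> [exists v in S, resolves v x y]].

Definition degree (x : V) : nat := #|[set y | G x y]|.

Definition leaf (x : V) : bool := degree x == 1.

End Graphs.

Definition isomorphic (V W : finType) (G : sgraph V) (H : sgraph W) : Prop :=
  exists2 f : V -> W, bijective f & forall x y, H (f x) (f y) = G x y.

Definition path_adj (n : nat) : rel 'I_n :=
  fun i j => (i.+1 == j :> nat) || (j.+1 == i :> nat).

Fact path_adj_sym n : symmetric (@path_adj n).
Proof. by move=> i j; rewrite /path_adj orbC. Qed.

Fact path_adj_irr n : irreflexive (@path_adj n).
Proof. by move=> i; rewrite /path_adj orbb gtn_eqF. Qed.

Definition path_graph (n : nat) : sgraph 'I_n :=
  SGraph (@path_adj_sym n) (@path_adj_irr n).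

Definition is_path_graph (V : finType) (G : sgraph V) : Prop :=
  isomorphic G (path_graph #|V|).

Section Families.

Variables (V I : finType) (G : I -> sgraph V).

Definition sim_metric_generator (S : {set V}) : bool :=
  [forall i, metric_generator (G i) S].

(* [set: V] is always a simultaneous metric generator, as each vertex is the
   only one at distance 0 from itself; hence this is a genuine minimum. *)
Definition Sd : nat :=
  #|[arg min_(S < [set: V] | sim_metric_generator S) #|S|]|.

End Families.

(* Main.v *)
Require Import Defs.
From mathcomp Require Import all_boot zify.

(** The distances from a vertex [v] of a connected graph take values in
    [0, ..., #|V| - 1], so [v] alone resolves all pairs exactly when
    [dist G v] is a bijection onto this interval.  In that case adjacent
    vertices get consecutive values (neighbours differ by at most one, and
    injectivity excludes equality), and vertices with consecutive values are
    adjacent (a vertex at distance [k.+1] has a neighbour at distance [k],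
    and only one vertex is at that distance).  Hence [dist G v] is an
    isomorphism onto the path graph that sends [v] to the end [0]
    ([is_path_graph_of_dist_inj], [leaf_of_dist_inj]).

    Conversely, give the vertices of a path their positions [f].  The distance
    between two vertices is the difference of their positions
    ([dist_path_coord]), so [v] fails to resolve [x != y] only if [v] is the
    midpoint of [x] and [y], that is [f x + f y = 2 * f v]
    ([path_unresolved_midpoint]).  A leaf is never such a midpoint, and two
    distinct vertices cannot both be the midpoint of the same pair; so a common
    leaf is a simultaneous metric generator of a family of paths, and so is any
    pair of distinct vertices.  The empty set resolves nothing, whence the
    lower bound. *)

Set Implicit Arguments.
Unset Strict Implicit.
Unset Printing Implicit Defensive.

(** * Distances and walks *)

Section Distance.

Variables (V : finType) (G : sgraph V).
Implicit Types (u v x y : V) (p : seq V).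

(** Removing the loops of a walk yields a path that is no longer than the walk
    and short enough to be met by the search that defines [dist]. *)
Lemma walk_shorten x p : path G x p ->
  exists2 k, k <= size p & (k < #|V|) && has_path_of_length G x (last x p) k.
Proof.
case/shortenP=> q Gq Uq /(uniq_leq_size (proj2 (andP Uq))) le_q.
exists (size q) => //; apply/andP; split.
  by have := max_card (mem (x :: q)); rewrite (card_uniqP Uq).
by apply/existsP; exists (in_tuple q); rewrite Gq Uq eqxx.
Qed.

Lemma dist_le_walk x p : path G x p -> dist G x (last x p) <= size p.
Proof.
case/walk_shorten=> k le_k /andP[lt_k Pk]; apply: leq_trans le_k.
rewrite /dist leqNgt; apply/negP => /(before_find 0).
by rewrite nth_iota // add0n Pk.
Qed.

Lemma connect_dist_lt x y : connect G x y ->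
  has_path_of_length G x y (dist G x y) && (dist G x y < #|V|).
Proof.
case/connectP=> p /walk_shorten[k _ /andP[lt_k Pk]] ->.
have hasP: has (has_path_of_length G x (last x p)) (iota 0 #|V|).
  by apply/hasP; exists k; rewrite ?mem_iota.
have lt_d: dist G x (last x p) < #|V| by move: hasP; rewrite has_find size_iota.
by have := nth_find 0 hasP; rewrite -/(dist G x _) nth_iota // add0n lt_d andbT.
Qed.

Lemma dist_walk x y : connect G x y ->
  exists p, [/\ path G x p, last x p = y & size p = dist G x y].
Proof.
case/connect_dist_lt/andP=> /existsP[p /and3P[Gp _ /eqP pE]] _.
by exists p; rewrite size_tuple.
Qed.

Lemma distxx x : dist G x x = 0.
Proof. by apply/eqP; rewrite -leqn0; apply: (@dist_le_walk x [::]). Qed.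

(** Breadth-first labellings compute distances: a walk cannot climb the labels
    faster than one unit per step, and following predecessors down to label
    [0] yields a walk of exactly the right length. *)
Lemma dist_labelling v (d : V -> nat) :
    (forall x, (d x == 0) = (x == v)) ->
    (forall x y, G x y -> d y <= (d x).+1) ->
    (forall x, 0 < d x -> exists2 y, G y x & d x = (d y).+1) ->
  forall x, dist G v x = d x.
Proof.
move=> d0 d_step d_pred x.
have [p [Gp <- szp]]: exists p, [/\ path G v p, last v p = x & size p = d x].
  elim: {x}(d x) {-2}x (erefl (d x)) => [|k IHk] x dx.
    by exists [::]; split=> //; apply/esym/eqP; rewrite -d0 dx.
  have [|y Gyx dy] := d_pred x; first by rewrite dx.
  have [|p [Gp py szp]] := IHk y; first by apply: succn_inj; rewrite -dy.
  by exists (rcons p x); rewrite rcons_path Gp py Gyx last_rcons size_rcons szp.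
have lip q u : path G u q -> d (last u q) <= d u + size q.
  elim: q u => [|y q IHq] u /=; first by rewrite addn0.
  by case/andP=> /d_step du /IHq dq; lia.
have /dist_walk[q [/lip dq qE szq]]: connect G v (last v p).
  by apply/connectP; exists p.
have dv: d v = 0 by apply/eqP; rewrite d0.
move: (dist_le_walk Gp) dq; rewrite szq szp qE dv; lia.
Qed.

Hypothesis connG : is_connected G.

Lemma dist_eq0 x y : (dist G x y == 0) = (x == y).
Proof.
apply/eqP/eqP=> [d0|->]; last exact: distxx.
have [p [_ pE]] := dist_walk (connG x y).
by rewrite d0 -pE => /size0nil->.
Qed.

Lemma dist_adj_le v x y : G x y -> dist G v y <= (dist G v x).+1.
Proof.
move=> Gxy; have [p [Gp px <-]] := dist_walk (connG v x).
have := @dist_le_walk v (rcons p y).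
by rewrite rcons_path Gp px last_rcons size_rcons; apply.
Qed.

(** The last edge of a shortest path from [v] leads to [y] from a vertex which
    is closer to [v]. *)
Lemma dist_pred v y k : dist G v y = k.+1 ->
  exists2 x, G x y & dist G v x = k.
Proof.
move=> dy; have [p] := dist_walk (connG v y); rewrite dy.
case/lastP: p => [[]//|p z]; rewrite rcons_path last_rcons size_rcons.
move=> [/andP[Gp Gy] zy [szp]]; rewrite zy in Gy; exists (last v p) => //.
by move: (dist_le_walk Gp) (dist_adj_le v Gy); lia.
Qed.

(** * Graphs resolved by a single vertex *)

Variable v : V.
Hypothesis dist_inj : injective (dist G v).

Lemma adj_dist_inj x y : G x y =
  ((dist G v x).+1 == dist G v y) || ((dist G v y).+1 == dist G v x).
Proof.
apply/idP/idP=> [Gxy|].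
  have neq_d: dist G v x != dist G v y.
    by apply/eqP=> /dist_inj eq_xy; rewrite eq_xy adj_irr in Gxy.
  have := dist_adj_le v Gxy; rewrite adj_sym in Gxy.
  by have := dist_adj_le v Gxy; lia.
by case/orP=> /eqP/esym/dist_pred[z Gz /dist_inj <-] //; rewrite adj_sym.
Qed.

Lemma is_path_graph_of_dist_inj : is_path_graph G.
Proof.
have d_lt x: dist G v x < #|V| by case/andP: (connect_dist_lt (connG v x)).
exists (fun x => Ordinal (d_lt x)); last by move=> x y; rewrite adj_dist_inj.
by apply: inj_card_bij; rewrite ?card_ord // => x y [/dist_inj].
Qed.

(** A path from [v] to some other vertex starts with an edge at [v],
    and injectivity leaves only one vertex at distance 1. *)
Lemma leaf_of_dist_inj : 1 < #|V| -> leaf G v.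
Proof.
case/card_gt1P=> a [b [_ _ neq_ab]].
have [x neq_vx]: exists x, v != x.
  by case: (eqVneq v a) neq_ab => [<-|]; [exists b | exists a].
have [y Gvy]: exists y, G v y.
  have /connectP[[_ /= xv|y p /=]] := connG v x.
    by rewrite xv eqxx in neq_vx.
  by case/andP=> Gvy _ _; exists y.
apply/cards1P; exists y; apply/setP=> z; rewrite !inE.
apply/idP/eqP=> [|-> //].
have d1 w: G v w -> dist G v w = 1.
  by rewrite adj_dist_inj distxx orbF => /eqP <-.
by move=> /d1 dz; apply: dist_inj; rewrite dz d1.
Qed.

End Distance.

Lemma metric_generator1P (V : finType) (G : sgraph V) (v : V) :
  reflect (injective (dist G v)) (metric_generator G [set v]).
Proof.
apply: (iffP forallP) => [gen x y eq_d | d_inj x].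
  apply/eqP/negPn/negP => neq_xy.
  have /exists_inP[w /set1P->] := implyP (forallP (gen x) y) neq_xy.
  by rewrite /resolves eq_d eqxx.
apply/forallP=> y; apply/implyP=> neq_xy; apply/exists_inP.
by exists v; rewrite ?set11 // /resolves (inj_eq d_inj).
Qed.

(** * Paths *)

(** Reading positions as natural numbers gives access to linear arithmetic. *)
Lemma path_coord (V : finType) (G : sgraph V) : is_path_graph G ->
  exists f : V -> nat,
    [/\ injective f, forall x, f x < #|V|,
        forall k, k < #|V| -> exists x, f x = k
      & forall x y, G x y = ((f x).+1 == f y) || ((f y).+1 == f x)].
Proof.
case=> f bij_f adj_f; exists (fun x => val (f x)); split=> [x y|x|k lt_k|x y].
- by move/val_inj/(bij_inj bij_f).
- exact: ltn_ord.
- by case: bij_f => g _ gK; exists (g (Ordinal lt_k)); rewrite gK.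
by rewrite -adj_f.
Qed.

Section PathCoordinates.

Variables (V : finType) (G : sgraph V) (f : V -> nat).
Hypotheses (f_inj : injective f) (f_lt : forall x, f x < #|V|).
Hypothesis f_surj : forall k, k < #|V| -> exists x, f x = k.
Hypothesis f_adj :
  forall x y, G x y = ((f x).+1 == f y) || ((f y).+1 == f x).

(** With truncated subtraction the sum on the right is the absolute difference,
    one of its two terms being zero. *)
Lemma dist_path_coord v x : dist G v x = (f v - f x) + (f x - f v).
Proof.
move: x; apply: dist_labelling => [x|x y|x].
- by rewrite -(inj_eq f_inj); lia.
- by rewrite f_adj; lia.
case: (ltngtP (f x) (f v)) => [lt_xv|lt_vx|->] d_gt0; last by lia.
- have [|y fy] := @f_surj (f x).+1; first by apply: leq_ltn_trans (f_lt v).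
  by exists y; rewrite ?f_adj fy; lia.
have [|y fy] := @f_surj (f x).-1; first by apply: leq_ltn_trans (f_lt x); lia.
by exists y; rewrite ?f_adj fy; lia.
Qed.

Lemma path_unresolved_midpoint v x y :
  x != y -> ~~ resolves G v x y -> f x + f y = (f v).*2.
Proof.
by rewrite /resolves !dist_path_coord -(inj_eq f_inj); lia.
Qed.

(** A vertex strictly between two others on the path has a neighbour on either
    side. *)
Lemma leaf_not_midpoint v x y :
  leaf G v -> x != y -> f x + f y != (f v).*2.
Proof.
case/cards1P=> w nbr_v neq_xy; apply/eqP=> mid.
have nbr u: G v u -> u = w by move=> Gvu; apply/set1P; rewrite -nbr_v inE.
have [a fa] : exists a, f a = (f v).+1.
  rewrite -(inj_eq f_inj) in neq_xy.
  by apply: f_surj; have := f_lt x; have := f_lt y; lia.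
have [b fb] : exists b, f b = (f v).-1.
  by apply: f_surj; apply: leq_ltn_trans (f_lt v); lia.
have := neq_xy; rewrite -(inj_eq f_inj) => neq_f.
have aw: a = w by apply: nbr; rewrite f_adj; lia.
have bw: b = w by apply: nbr; rewrite f_adj; lia.
by move: fa fb; rewrite aw bw; lia.
Qed.

End PathCoordinates.

Lemma metric_generator_leaf (V : finType) (G : sgraph V) (v : V) :
  is_path_graph G -> leaf G v -> metric_generator G [set v].
Proof.
case/path_coord=> f [f_inj f_lt f_surj f_adj] leaf_v.
apply/metric_generator1P => x y eq_d; apply/eqP/negPn/negP => neq_xy.
have /eqP[] := leaf_not_midpoint f_inj f_lt f_surj f_adj leaf_v neq_xy.
apply: (path_unresolved_midpoint f_inj f_lt f_surj f_adj neq_xy).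
by rewrite /resolves eq_d eqxx.
Qed.

Lemma metric_generator_pair (V : finType) (G : sgraph V) (u v : V) :
  is_path_graph G -> u != v -> metric_generator G [set u; v].
Proof.
case/path_coord=> f [f_inj f_lt f_surj f_adj] neq_uv.
apply/forallP=> x; apply/forallP=> y; apply/implyP=> neq_xy.
have mid w := path_unresolved_midpoint f_inj f_lt f_surj f_adj (v := w) neq_xy.
apply/exists_inP; case: (boolP (resolves G u x y)) => [|/mid mid_u].
  by exists u; rewrite // set21.
exists v; first by rewrite set22.
apply: contraTT neq_uv => /mid; rewrite mid_u => /double_inj/f_inj->.
by rewrite eqxx.
Qed.

(** * Simultaneous metric dimension *)

Section Dimension.

Variables (V I : finType) (G : I -> sgraph V).
Hypothesis G_connected : forall i, is_connected (G i).

(** The set of all vertices is a simultaneous metric generator, as each vertex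
    is the only one at distance 0 from itself; so the minimum is attained. *)
Lemma Sd_attained : exists S, [/\ sim_metric_generator G S, #|S| = Sd G
  & forall T, sim_metric_generator G T -> Sd G <= #|T|].
Proof.
rewrite /Sd; case: arg_minnP => [|S gen_S min_S]; last by exists S.
apply/forallP=> i; apply/forallP=> x; apply/forallP=> y; apply/implyP=> neq_xy.
apply/exists_inP; exists x; rewrite ?inE // /resolves distxx eq_sym.
by rewrite dist_eq0.
Qed.

Lemma Sd_le S : sim_metric_generator G S -> Sd G <= #|S|.
Proof. by case: Sd_attained => _ [_ _ min_S] /min_S. Qed.

Lemma Sd_gt0 : 1 < #|V| -> 0 < #|I| -> 0 < Sd G.
Proof.
case/card_gt1P=> x [y [_ _ neq_xy]] /card_gt0P[i _].
have [S [gen_S <- _]] := Sd_attained; rewrite card_gt0.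
have /forallP/(_ y)/implyP/(_ neq_xy) := forallP (forallP gen_S i) x.
by case/exists_inP=> v vS _; apply/set0Pn; exists v.
Qed.

Lemma Sd_eq1P : 1 < #|V| -> 0 < #|I| ->
  Sd G = 1 <-> exists v, forall i, metric_generator (G i) [set v].
Proof.
move=> V_gt1 I_gt0; split=> [Sd1 | [v gen_v]].
  have [S [/forallP gen_S /eqP + _]] := Sd_attained.
  by rewrite Sd1 => /cards1P[v Sv]; exists v => i; rewrite -Sv.
apply/eqP; rewrite eqn_leq Sd_gt0 // andbT -(cards1 v) Sd_le //.
exact/forallP.
Qed.

End Dimension.

Theorem theorem3p1 (V I : finType) (G : I -> sgraph V)
    (V_ge2 : 2 <= #|V|) (I_nonempty : 0 < #|I|)
    (G_connected : forall i : I, is_connected (G i)) :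
  (Sd G = 1 <->
     (forall i : I, is_path_graph (G i)) /\
     (exists v : V, forall i : I, leaf (G i) v)) /\
  ((forall i : I, is_path_graph (G i)) -> 1 <= Sd G <= 2).
Proof.
split; last first.
  move=> paths; have /card_gt1P[u [v [_ _ neq_uv]]] := V_ge2.
  rewrite Sd_gt0 //=; have <-: #|[set u; v]| = 2 by rewrite cards2 neq_uv.
  by apply/Sd_le/forallP => // i; apply: metric_generator_pair.
apply: (iff_trans (Sd_eq1P G_connected V_ge2 I_nonempty)); split.
  case=> v gen_v; split; [move=> i | exists v => i];
    have /metric_generator1P d_inj := gen_v i.
  - exact: is_path_graph_of_dist_inj d_inj.
  exact: leaf_of_dist_inj d_inj V_ge2.
by case=> paths [v leaf_v]; exists v => i; apply: metric_generator_leaf.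
Qed.
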